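(* Fix $\widetilde A\in\mathbb{R}^{m\times n}$ and $\widetilde b\in\mathbb{R}^m$. For a pair $(A,b)\in\mathbb{R}^{m\times n}\times\mathbb{R}^m$ put $E=\widetilde A-A$, $\epsilon=\widetilde b-b$ and $x_{\rm LS}=A^\dagger b$. Let $(\widehat A,\widehat b)\in\mathbb{R}^{m\times n}\times\mathbb{R}^m$ be a minimizer of $\|Ex_{\rm LS}-\epsilon\|$ among all pairs $(A,b)$ subject to the constraint that $Ax=b$ is consistent, i.e. $$(\widehat A,\widehat b)\in\arg\min_{\substack{(A,b)\in\mathbb{R}^{m\times n}\times\mathbb{R}^m\\ Ax=b\ \text{is consistent}}}\|Ex_{\rm LS}-\epsilon\|.$$ Denote $\widehat E=\widetilde A-\widehat A$, $\widehat\epsilon=\widetilde b-\widehat b$, $\widehat x_{\rm LS}=\widehat A^\dagger\widehat b$ and $\widetilde x_{\rm LS}=\widetilde A^\dagger\widetilde b$. Then $$\|\widehat E\widehat x_{\rm LS}-\widehat\epsilon\|=\|\widetilde A\widetilde x_{\rm LS}-\widetilde b\|$$ and $$\widehat x_{\rm LS}=\widetilde x_{\rm LS}+y\quad\text{with } y\in\mathrm{null}(\widetilde A).$$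
   Context: $\|\cdot\|$ is the Euclidean norm on $\mathbb{R}^m$, $M^\dagger$ is the Moore–Penrose pseudoinverse of $M$, and a linear system $Ax=b$ is consistent if it has at least one solution $x\in\mathbb{R}^n$. *)

(* Defs.v *)
From mathcomp Require Import all_boot all_order all_algebra.

Set Implicit Arguments.
Unset Strict Implicit.
Unset Printing Implicit Defensive.

Import Order.TTheory GRing.Theory Num.Theory.
Local Open Scope ring_scope.

(* MathComp-Analysis equips matrices with the sup norm, hence this one. *)
Definition enorm (R : rcfType) (m : nat) (v : 'cV[R]_m) : R :=
  Num.sqrt (\sum_(i < m) v i 0 ^+ 2).

Definition consistent (R : rcfType) (m n : nat)
  (A : 'M[R]_(m, n)) (b : 'cV[R]_m) : Prop :=
  exists x : 'cV[R]_n, A *m x = b.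

Definition penrose (R : rcfType) (m n : nat)
  (A : 'M[R]_(m, n)) (X : 'M[R]_(n, m)) : bool :=
  [&& A *m X *m A == A, X *m A *m X == X,
      (A *m X)^T == A *m X & (X *m A)^T == X *m A].

Lemma mulmx_tr_eq0 (R : rcfType) (m n : nat) (B : 'M[R]_(m, n)) :
  B *m B^T = 0 -> B = 0.
Proof.
move=> BBT0; apply/matrixP=> i j; rewrite mxE; apply/eqP.
have /eqP := congr1 (fun M : 'M_m => M i i) BBT0; rewrite !mxE.
rewrite psumr_eq0 => [/allP/(_ j (mem_index_enum j))|k _]; last first.
  by rewrite mxE -expr2 sqr_ge0.
by rewrite mxE mulf_eq0 orbb.
Qed.

Lemma row_free_gram_unit (R : rcfType) (r n : nat) (B : 'M[R]_(r, n)) :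
  row_free B -> B *m B^T \in unitmx.
Proof.
move=> Bfree; rewrite -row_free_unit -kermx_eq0; apply/eqP.
set K := kermx _; have KB : (K *m B) *m (K *m B)^T = 0.
  by rewrite trmx_mul !mulmxA -(mulmxA K) mulmx_ker mul0mx.
by apply: (row_free_inj Bfree); rewrite mul0mx; apply: mulmx_tr_eq0.
Qed.

Lemma penrose_factor (R : rcfType) (m r n : nat)
  (C : 'M[R]_(m, r)) (F : 'M[R]_(r, n)) :
  row_free C^T -> row_free F ->
  penrose (C *m F)
    (F^T *m invmx (F *m F^T) *m (invmx (C^T *m C) *m C^T)).
Proof.
move=> /row_free_gram_unit; rewrite trmxK => uC /row_free_gram_unit uF.
set P := invmx (F *m F^T); set Q := invmx (C^T *m C).
have PT : P^T = P by rewrite /P trmx_inv trmx_mul trmxK.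
have QT : Q^T = Q by rewrite /Q trmx_inv trmx_mul trmxK.
have FP : F *m (F^T *m P) = 1%:M by rewrite mulmxA mulmxV.
have QC : Q *m C^T *m C = 1%:M by rewrite -mulmxA mulVmx.
have AX : C *m F *m (F^T *m P *m (Q *m C^T)) = C *m (Q *m C^T).
  by rewrite -(mulmxA C) (mulmxA F) FP mul1mx.
have XA : F^T *m P *m (Q *m C^T) *m (C *m F) = F^T *m P *m F.
  by rewrite -(mulmxA (F^T *m P)) (mulmxA (Q *m C^T)) QC mul1mx.
rewrite /penrose AX XA; apply/and4P; split; apply/eqP.
- by rewrite -(mulmxA C) (mulmxA (Q *m C^T)) QC mul1mx.
- by rewrite -(mulmxA (F^T *m P) F) (mulmxA F) FP mul1mx.
- by rewrite !trmx_mul trmxK QT mulmxA.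
- by rewrite !trmx_mul trmxK PT mulmxA.
Qed.

Lemma penrose_exists (R : rcfType) (m n : nat) (A : 'M[R]_(m, n)) :
  exists X, penrose A X.
Proof.
have := @penrose_factor _ _ _ _ (col_base A) (row_base A).
rewrite mulmx_base => penA; eexists; apply: penA; last exact: row_base_free.
by rewrite /row_free mxrank_tr; apply: col_base_full.
Qed.

Lemma penrose_unique (R : rcfType) (m n : nat)
  (A : 'M[R]_(m, n)) (X Y : 'M[R]_(n, m)) :
  penrose A X -> penrose A Y -> X = Y.
Proof.
move=> /and4P[/eqP X1 /eqP X2 /eqP X3 /eqP X4].
move=> /and4P[/eqP Y1 /eqP Y2 /eqP Y3 /eqP Y4].
have AXY : A *m X = A *m Y.
  by rewrite -X3 -{1}Y1 -mulmxA trmx_mul X3 Y3 mulmxA X1.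
have XAY : X *m A = Y *m A.
  by rewrite -X4 -{1}Y1 -mulmxA mulmxA trmx_mul Y4 X4 -mulmxA (mulmxA A) X1.
by rewrite -X2 -mulmxA AXY mulmxA XAY Y2.
Qed.

(* The Moore-Penrose pseudoinverse (mathcomp's pinvmx is only a generalized
   inverse); the choice is immaterial by penrose_unique. *)
Definition mp_inv (R : rcfType) (m n : nat) (A : 'M[R]_(m, n)) : 'M[R]_(n, m) :=
  xchoose (penrose_exists A).

Lemma mp_invP (R : rcfType) (m n : nat) (A : 'M[R]_(m, n)) :
  penrose A (mp_inv A).
Proof. exact: xchooseP. Qed.

Definition x_LS (R : rcfType) (m n : nat)
  (A : 'M[R]_(m, n)) (b : 'cV[R]_m) : 'cV[R]_n := mp_inv A *m b.

Definition is_argmin (R : rcfType) (T : Type) (P : T -> Prop) (f : T -> R)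
  (t : T) : Prop :=
  P t /\ forall u : T, P u -> f t <= f u.

(* Main.v *)
Require Import Defs.
From mathcomp Require Import all_boot all_order all_algebra.
From mathcomp Require Import reals.

Import Order.TTheory GRing.Theory Num.Theory.
Local Open Scope ring_scope.

(** For a consistent pair (A, b) the vector x_LS A b solves A x = b, so the
    residual E x_LS - eps collapses to At x_LS - bt: the objective depends on
    (A, b) only through the vector x_LS A b, and it is the least-squares
    objective of the perturbed system (At, bt) at that vector.  The pair
    (At, At xt), with xt = x_LS At bt, is consistent and has xt itself as its
    pseudoinverse solution, so the minimizer xh satisfies
    |At xh - bt| <= |At xt - bt| (x_LS_mulmx_x_LS).

    On the other hand xt is a least-squares solution: its residual is
    orthogonal to the range of At, and Pythagoras gives
    |At x - bt|^2 = |At (x - xt)|^2 + |At xt - bt|^2 for every x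
    (enorm_residual_sqr).  At x = xh the two facts force At (xh - xt) = 0, so
    xh - xt lies in the null space of At, and the two residuals coincide. *)

Lemma enorm_sqr (R : rcfType) (m : nat) (v : 'cV[R]_m) :
  enorm v ^+ 2 = (v^T *m v) 0 0.
Proof.
rewrite /enorm sqr_sqrtr ?sumr_ge0 // => [|i _]; last exact: sqr_ge0.
by rewrite mxE; apply: eq_bigr => i _; rewrite mxE expr2.
Qed.

Lemma enorm_ge0 (R : rcfType) (m : nat) (v : 'cV[R]_m) : 0 <= enorm v.
Proof. exact: sqrtr_ge0. Qed.

Lemma enorm_eq0 (R : rcfType) (m : nat) (v : 'cV[R]_m) : enorm v = 0 -> v = 0.
Proof.
move=> v0; apply: trmx_inj; rewrite trmx0; apply: mulmx_tr_eq0.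
by rewrite trmxK [LHS]mx11_scalar -enorm_sqr v0 expr0n raddf0.
Qed.

Lemma enorm_sqrD_orth (R : rcfType) (m : nat) (u v : 'cV[R]_m) :
  u^T *m v = 0 -> enorm (u + v) ^+ 2 = enorm u ^+ 2 + enorm v ^+ 2.
Proof.
move=> uv0; have vu0 : v^T *m u = 0.
  by rewrite -[LHS]trmxK trmx_mul trmxK uv0 trmx0.
have DT : (u + v)^T = u^T + v^T by rewrite linearD.
by rewrite !enorm_sqr DT mulmxDl !mulmxDr uv0 vu0 addr0 add0r mxE.
Qed.

(** If A x = b then b = A A^+ A x, since A A^+ A = A. *)
Lemma mulmx_x_LS (R : rcfType) (m n : nat) (A : 'M[R]_(m, n)) (b : 'cV[R]_m) :
  consistent A b -> A *m x_LS A b = b.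
Proof.
case=> x <-; rewrite /x_LS !mulmxA.
by have /and4P[/eqP-> _ _ _] := mp_invP A.
Qed.

(** Projecting the right-hand side onto the range of A makes the system
    consistent without moving its pseudoinverse solution, since
    A^+ A A^+ = A^+; hence every pseudoinverse solution is reached by a
    consistent pair. *)
Lemma x_LS_mulmx_x_LS (R : rcfType) (m n : nat)
    (A : 'M[R]_(m, n)) (b : 'cV[R]_m) :
  x_LS A (A *m x_LS A b) = x_LS A b.
Proof.
rewrite /x_LS !mulmxA.
by have /and4P[_ /eqP-> _ _] := mp_invP A.
Qed.

(** The normal equations: A A^+ is symmetric, so A^T A A^+ = (A A^+ A)^T
    = A^T. *)
Lemma trmx_mul_residual_x_LS (R : rcfType) (m n : nat)
    (A : 'M[R]_(m, n)) (b : 'cV[R]_m) :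
  A^T *m (A *m x_LS A b - b) = 0.
Proof.
have /and4P[/eqP AXA _ /eqP AXT _] := mp_invP A.
by rewrite mulmxBr /x_LS (mulmxA A) -AXT mulmxA -trmx_mul AXA subrr.
Qed.

Lemma enorm_residual_sqr (R : rcfType) (m n : nat)
    (A : 'M[R]_(m, n)) (b : 'cV[R]_m) (x : 'cV[R]_n) :
  enorm (A *m x - b) ^+ 2 =
  enorm (A *m (x - x_LS A b)) ^+ 2 + enorm (A *m x_LS A b - b) ^+ 2.
Proof.
rewrite -enorm_sqrD_orth; last first.
  by rewrite trmx_mul -mulmxA trmx_mul_residual_x_LS mulmx0.
by rewrite mulmxBr addrA subrK.
Qed.

Lemma residual_consistent (R : rcfType) (m n : nat)
    (At A : 'M[R]_(m, n)) (bt b : 'cV[R]_m) :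
  consistent A b ->
  (At - A) *m x_LS A b - (bt - b) = At *m x_LS A b - bt.
Proof.
by move=> Ab; rewrite mulmxBl mulmx_x_LS // opprB addrA subrK.
Qed.

Theorem theorem8 (R : realType) (m n : nat)
    (At : 'M[R]_(m, n)) (bt : 'cV[R]_m)
    (Ah : 'M[R]_(m, n)) (bh : 'cV[R]_m) :
  is_argmin
    (fun p : 'M[R]_(m, n) * 'cV[R]_m => consistent p.1 p.2)
    (fun p : 'M[R]_(m, n) * 'cV[R]_m =>
       let E := At - p.1 in
       let eps := bt - p.2 in
       enorm (E *m x_LS p.1 p.2 - eps))
    (Ah, bh) ->
  let Eh := At - Ah in
  let epsh := bt - bh in
  let xh := x_LS Ah bh in
  let xt := x_LS At bt in
  enorm (Eh *m xh - epsh) = enorm (At *m xt - bt) /\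
  exists y : 'cV[R]_n, At *m y = 0 /\ xh = xt + y.
Proof.
case=> /= Ahbh min_h.
have cons_t : consistent At (At *m x_LS At bt) by exists (x_LS At bt).
have := min_h (At, At *m x_LS At bt) cons_t.
rewrite /= !residual_consistent // x_LS_mulmx_x_LS => le_ht.
have le_sqr : enorm (At *m x_LS Ah bh - bt) ^+ 2
              <= enorm (At *m x_LS At bt - bt) ^+ 2.
  by rewrite ler_sqr ?nnegrE ?enorm_ge0.
have null_d : At *m (x_LS Ah bh - x_LS At bt) = 0.
  apply/enorm_eq0/eqP; rewrite -sqrf_eq0 eq_le sqr_ge0 andbT.
  by rewrite enorm_residual_sqr gerDr in le_sqr.
split; last by exists (x_LS Ah bh - x_LS At bt); split; rewrite // [RHS]addrC subrK.
by move/eqP: null_d; rewrite mulmxBr subr_eq0 => /eqP->.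
Qed.
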